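(* Let $G$ and $H$ be groups acting on themselves and on each other. If the mutual actions are fully compatible, then $\eta(G,H)\cong \big(\tau(G,H)\rtimes H\big)\rtimes G$ and $\tau(G,H)\cong G\boxtimes H$.
   Context: All actions are left actions by automorphisms. $G$ and $H$ act on themselves and on each other through homomorphisms $\rho_G\colon G\to \mathrm{Aut}(G)$, $\rho_H\colon H\to\mathrm{Aut}(H)$, $\sigma_G\colon G\to\mathrm{Aut}(H)$, $\sigma_H\colon H\to \mathrm{Aut}(G)$ (a group need not act on itself by conjugation). For $a,b\in G\cup H$ (disjoint union), ${}^{a}b$ denotes the result of acting by $a$ on $b$. The actions are fully compatible if ${}^{({}^{a}b)}c={}^{a}\big({}^{b}({}^{a^{-1}}c)\big)$ for all $a,b,c\in G\cup H$. The box-tensor product $G\boxtimes H$ is the group generated by the symbols $g\boxtimes h$ ($g\in G$, $h\in H$) subject to the relations $gg'\boxtimes h=({}^{g}g'\boxtimes {}^{g}h)(g\boxtimes h)$ and $g\boxtimes hh'=(g\boxtimes h)({}^{h}g\boxtimes {}^{h}h')$ for all $g,g'\in G$, $h,h'\in H$. In the free product $G*H$ write $[u,v]=uvu^{-1}v^{-1}$, and let $[G,H]$ be the (normal) subgroup generated by all $[g,h]$, $g\in G$, $h\in H$. Let $R\subset G*H$ be the set of all elements $x[g,h]^{-1}x^{-1}\,[{}^{x}g,{}^{x}h]$ and $y[g',h']^{-1}y^{-1}\,[{}^{y}g',{}^{y}h']$ with $g,g',x\in G\setminus\{1\}$ and $h,h',y\in H\setminus\{1\}$ (here ${}^{x}g,{}^{x}h,{}^{y}g',{}^{y}h'$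 are given by the actions), and let $R^{G*H}$ be its normal closure in $G*H$; it is contained in $[G,H]$. Put $\eta(G,H)=(G*H)/R^{G*H}$ and $\tau(G,H)=[G,H]/R^{G*H}$. Identify $[g,h]$ with its class in $\tau(G,H)$. The semidirect products are formed with the following actions: $H$ (and likewise $G$) acts on $\tau(G,H)$ by ${}^{x}[g',h']=[{}^{x}g',{}^{x}h']$, and $G$ acts on $\tau(G,H)\rtimes H$ by ${}^{g}(b,h)=\big({}^{g}b\cdot[g,h],\,h\big)$ for $b\in\tau(G,H)$, $h\in H$; multiplication in a semidirect product $A\rtimes B$ is $(a_1,b_1)(a_2,b_2)=(a_1\,{}^{b_1}a_2,\,b_1b_2)$. *)

(* Defs.v *)
From HB Require Import structures.
From mathcomp Require Import all_boot.
From mathcomp Require Import boolp.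

Set Implicit Arguments.
Unset Strict Implicit.
Unset Printing Implicit Defensive.

Local Open Scope group_scope.

Definition isomorphic (G H : groupType) : Prop :=
  exists f : {multiplicative G -> H}, bijective f.

(* An action of A on X by automorphisms, i.e. a homomorphism A -> Aut(X):
   bijectivity of [act a] follows from the first two laws. *)
Record gaction (A X : groupType) := GAction {
  act :> A -> X -> X;
  act1 : forall x, act 1 x = x;
  actM : forall a b x, act (a * b) x = act a (act b x);
  act_morph : forall a, {morph act a : x y / x * y}
}.

(* The library's [~ x, y] is x^-1 y^-1 x y. *)
Definition comm (G : groupType) (x y : G) : G := x * y * x^-1 * y^-1.

Section Generated.
Variables (G : groupType) (S : G -> Prop).

Inductive generated_by : G -> Prop :=
| Gen_sub x of S x : generated_by x
| Gen_1 : generated_by 1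
| Gen_M x y of generated_by x & generated_by y : generated_by (x * y)
| Gen_V x of generated_by x : generated_by x^-1.

Definition gen : {pred G} := [pred x | `[< generated_by x >]].

Fact gen_mul : mulg_closed gen.
Proof. by move=> x y /asboolP Sx /asboolP Sy; apply/asboolP/Gen_M. Qed.
Fact gen_one : 1 \in gen.
Proof. exact/asboolP/Gen_1. Qed.
Fact gen_inv : invg_closed gen.
Proof. by move=> x /asboolP Sx; apply/asboolP/Gen_V. Qed.

HB.instance Definition _ := isMulClosed.Build G gen gen_mul.
HB.instance Definition _ := isMul1Closed.Build G gen gen_one.
HB.instance Definition _ := isInvClosed.Build G gen gen_inv.

End Generated.

Section Subgroup.
Variables (G : groupType) (K : groupClosed G).

Record subgroup : Type := Subgroup {
  subgroup_val :> G;
  subgroup_valP : subgroup_val \in K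
}.

HB.instance Definition _ := [isSub for subgroup_val].
HB.instance Definition _ := [Choice of subgroup by <:].

Fact subgroup_closed : group_closed (fun x => x \in K).
Proof. by split; [exact: gpred1 | exact: gpredF]. Qed.

HB.instance Definition _ :=
  SubChoice_isSubGroup.Build G (fun x => x \in K) subgroup subgroup_closed.

Fact subgroup_val1 : subgroup_val 1 = 1. Proof. by []. Qed.
Fact subgroup_valM (x y : subgroup) :
  subgroup_val (x * y) = subgroup_val x * subgroup_val y.
Proof. by []. Qed.
Fact subgroup_valV (x : subgroup) : subgroup_val x^-1 = (subgroup_val x)^-1.
Proof. by []. Qed.

End Subgroup.

Record normal_subgroup (G : groupType) := NormalSubgroup {
  nsub :> groupClosed G;
  nsub_conj : forall x y, x \in nsub -> y * x * y^-1 \in nsub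
}.

Section Quotient.
Variables (G : groupType) (N : normal_subgroup G).

Definition same_coset : rel G := fun x y => x^-1 * y \in N.

Fact same_coset_refl : reflexive same_coset.
Proof. by move=> x; rewrite /same_coset mulVg gpred1. Qed.
Fact same_coset_sym : symmetric same_coset.
Proof. by move=> x y; rewrite /same_coset -gpredV invgM invgK. Qed.
Fact same_coset_trans : transitive same_coset.
Proof.
move=> y x z xy yz; rewrite /same_coset -(mulgK y x^-1) -mulgA.
exact: gpredM.
Qed.

Canonical same_coset_equiv :=
  EquivRel same_coset same_coset_refl same_coset_sym same_coset_trans.

Definition quotient : Type := {eq_quot same_coset}%qT.

HB.instance Definition _ := Choice.on quotient.
HB.instance Definition _ := EqQuotient.on quotient.

Definition quotient_pi (x : G) : quotient := \pi%qT x.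

Definition quotient_one : quotient := quotient_pi 1.
Definition quotient_mul (x y : quotient) : quotient :=
  quotient_pi (repr x * repr y).
Definition quotient_inv (x : quotient) : quotient := quotient_pi (repr x)^-1.

Fact quotient_piP x y : quotient_pi x = quotient_pi y <-> x^-1 * y \in N.
Proof. by split=> [/eqmodP | xy]; last exact/eqmodP. Qed.

Fact quotient_reprE x : exists2 n, n \in N & repr (quotient_pi x) = x * n.
Proof.
exists (x^-1 * repr (quotient_pi x)); last by rewrite mulVKg.
by apply/quotient_piP; rewrite /quotient_pi reprK.
Qed.

Fact quotient_piM x y :
  quotient_mul (quotient_pi x) (quotient_pi y) = quotient_pi (x * y).
Proof.
have [n nN e] := quotient_reprE x; have [m mN e'] := quotient_reprE y.
apply/quotient_piP; rewrite e e'.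
have -> : (x * n * (y * m))^-1 * (x * y) = m^-1 * (y^-1 * n^-1 * y^-1^-1).
  by rewrite invgK !invgM -!mulgA mulKg.
by rewrite gpredM ?nsub_conj ?gpredV.
Qed.

Fact quotient_piV x : quotient_inv (quotient_pi x) = quotient_pi x^-1.
Proof.
have [n nN e] := quotient_reprE x.
by apply/quotient_piP; rewrite e invgK nsub_conj.
Qed.

Fact quotient_ind (P : quotient -> Prop) :
  (forall x, P (quotient_pi x)) -> forall c, P c.
Proof. by move=> Px c; rewrite -[c]reprK; apply: Px. Qed.

Fact quotient_mulA : associative quotient_mul.
Proof.
elim/quotient_ind=> x; elim/quotient_ind=> y; elim/quotient_ind=> z.
by rewrite !quotient_piM mulgA.
Qed.
Fact quotient_mul1 : left_id quotient_one quotient_mul.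
Proof. by elim/quotient_ind=> x; rewrite quotient_piM mul1g. Qed.
Fact quotient_mulr1 : right_id quotient_one quotient_mul.
Proof. by elim/quotient_ind=> x; rewrite quotient_piM mulg1. Qed.
Fact quotient_mulV : left_inverse quotient_one quotient_inv quotient_mul.
Proof. by elim/quotient_ind=> x; rewrite quotient_piV quotient_piM mulVg. Qed.
Fact quotient_mulrV : right_inverse quotient_one quotient_inv quotient_mul.
Proof. by elim/quotient_ind=> x; rewrite quotient_piV quotient_piM mulgV. Qed.

HB.instance Definition _ := isGroup.Build quotient
  quotient_mulA quotient_mul1 quotient_mulr1 quotient_mulV quotient_mulrV.

End Quotient.

Section NormalClosure.
Variables (G : groupType) (S : G -> Prop).

Inductive conjugate_of : G -> Prop :=
| Conjugate_of x y of S x : conjugate_of (y * x * y^-1).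

Fact normal_closure_conj x y :
  x \in gen conjugate_of -> y * x * y^-1 \in gen conjugate_of.
Proof.
move=> /asboolP; elim=> {x} [_ [x z Sx]||u v _ IHu _ IHv|u _ IHu].
- apply/asboolP/Gen_sub; rewrite -(mulgA z) !mulgA -(mulgA _ z^-1) -invgM.
  exact: Conjugate_of.
- by rewrite mulg1 mulgV gpred1.
- have := gpredM _ _ IHu IHv; rewrite !mulgA.
  by rewrite -(mulgA _ y^-1 y) mulVg mulg1.
- by rewrite -gpredV !invgM !invgK mulgA.
Qed.

Definition normal_closure : normal_subgroup G :=
  NormalSubgroup normal_closure_conj.

End NormalClosure.

Section Subquotient.
Variables (G : groupType) (K : groupClosed G) (N : normal_subgroup G).

Definition trace : {pred subgroup K} := [pred x | subgroup_val x \in N].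

Fact trace_mul : mulg_closed trace.
Proof. by move=> x y xN yN; rewrite inE subgroup_valM gpredM. Qed.
Fact trace_one : 1 \in trace.
Proof. by rewrite inE subgroup_val1 gpred1. Qed.
Fact trace_inv : invg_closed trace.
Proof. by move=> x xN; rewrite inE subgroup_valV gpredV. Qed.

HB.instance Definition _ := isMulClosed.Build (subgroup K) trace trace_mul.
HB.instance Definition _ := isMul1Closed.Build (subgroup K) trace trace_one.
HB.instance Definition _ := isInvClosed.Build (subgroup K) trace trace_inv.

Fact trace_conj (x y : subgroup K) : x \in trace -> y * x * y^-1 \in trace.
Proof. by move=> xN; rewrite inE !subgroup_valM subgroup_valV nsub_conj. Qed.

Definition trace_normal : normal_subgroup (subgroup K) :=
  NormalSubgroup trace_conj.

(* This is K / (K :&: N), i.e. K / N when N is contained in K. *)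
Definition subquotient : Type := quotient trace_normal.

HB.instance Definition _ := Group.on subquotient.

End Subquotient.

Section Presentation.
Variables (X : choiceType).

(* Words in the generators and their inverses: (x, false) stands for x and
   (x, true) for x^-1. *)
Definition word : Type := seq (X * bool).

Definition word_inv (w : word) : word := [seq (a.1, ~~ a.2) | a <- rev w].

(* E u v is the defining relation u = v. *)
Variable E : word -> word -> Prop.

Inductive word_eq : word -> word -> Prop :=
| Word_rel u v of E u v : word_eq u v
| Word_cancel x b : word_eq [:: (x, b); (x, ~~ b)] [::]
| Word_refl u : word_eq u u
| Word_sym u v of word_eq u v : word_eq v u
| Word_trans u v w of word_eq u v & word_eq v w : word_eq u w
| Word_cat u u' v v' of word_eq u u' & word_eq v v' :
    word_eq (u ++ v) (u' ++ v').

Definition word_eqb : rel word := fun u v => `[< word_eq u v >].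

Fact word_eqb_refl : reflexive word_eqb.
Proof. by move=> u; apply/asboolP/Word_refl. Qed.
Fact word_eqb_sym : symmetric word_eqb.
Proof. by move=> u v; apply/asboolP/asboolP; apply: Word_sym. Qed.
Fact word_eqb_trans : transitive word_eqb.
Proof.
by move=> v u w /asboolP uv /asboolP vw; apply/asboolP/(Word_trans uv vw).
Qed.

Canonical word_equiv :=
  EquivRel word_eqb word_eqb_refl word_eqb_sym word_eqb_trans.

Definition presented : Type := {eq_quot word_eqb}%qT.

HB.instance Definition _ := Choice.on presented.
HB.instance Definition _ := EqQuotient.on presented.

Definition word_class (w : word) : presented := \pi%qT w.
Definition generator (x : X) : presented := word_class [:: (x, false)].

Definition presented_one : presented := word_class [::].
Definition presented_mul (u v : presented) : presented :=
  word_class (repr u ++ repr v).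
Definition presented_inv (u : presented) : presented :=
  word_class (word_inv (repr u)).

Fact word_classP u v : word_class u = word_class v <-> word_eq u v.
Proof.
by split=> [/eqmodP/asboolP // | uv]; apply/eqmodP/asboolP.
Qed.

Fact word_class_repr u : word_eq (repr (word_class u)) u.
Proof. by apply/word_classP; rewrite /word_class reprK. Qed.

Fact word_mulV w : word_eq (w ++ word_inv w) [::].
Proof.
elim: w => [|[x b] w IHw]; first exact: Word_refl.
rewrite /word_inv rev_cons map_rcons -cats1 /=.
apply: Word_trans (Word_cancel x b); rewrite catA.
apply: (@Word_cat [:: (x, b)] [:: (x, b)]); first exact: Word_refl.
apply: (@Word_cat _ [::]); last exact: Word_refl.
exact: IHw.
Qed.

Fact word_invK : involutive word_inv.
Proof.
move=> w; rewrite /word_inv -map_rev revK -map_comp map_id_in // => -[x b] _.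
by rewrite /= negbK.
Qed.

Fact word_Vmul w : word_eq (word_inv w ++ w) [::].
Proof. by rewrite -{2}[w]word_invK; exact: word_mulV. Qed.

Fact presented_mulE u v :
  presented_mul (word_class u) (word_class v) = word_class (u ++ v).
Proof. by apply/word_classP/Word_cat; apply: word_class_repr. Qed.

Fact presented_ind (P : presented -> Prop) :
  (forall w, P (word_class w)) -> forall u, P u.
Proof. by move=> Pw u; rewrite -[u]reprK; apply: Pw. Qed.

Fact presented_mulA : associative presented_mul.
Proof.
elim/presented_ind=> u; elim/presented_ind=> v; elim/presented_ind=> w.
by rewrite !presented_mulE catA.
Qed.
Fact presented_mul1 : left_id presented_one presented_mul.
Proof. by elim/presented_ind=> u; rewrite presented_mulE. Qed.
Fact presented_mulr1 : right_id presented_one presented_mul.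
Proof. by elim/presented_ind=> u; rewrite presented_mulE cats0. Qed.
Fact presented_mulV : left_inverse presented_one presented_inv presented_mul.
Proof.
move=> u; rewrite -{2}[u]reprK [presented_inv _]/(word_class _).
by rewrite -/(word_class (repr u)) presented_mulE; apply/word_classP/word_Vmul.
Qed.
Fact presented_mulrV : right_inverse presented_one presented_inv presented_mul.
Proof.
move=> u; rewrite -{1}[u]reprK [presented_inv _]/(word_class _).
by rewrite -/(word_class (repr u)) presented_mulE; apply/word_classP/word_mulV.
Qed.

HB.instance Definition _ := isGroup.Build presented
  presented_mulA presented_mul1 presented_mulr1 presented_mulV presented_mulrV.

End Presentation.

Section FreeProduct.
Variables (G H : groupType).

Inductive free_product_rel : word (G + H)%type -> word (G + H)%type -> Prop :=
| FreeProduct_l (g g' : G) : free_product_rel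
    [:: (inl g, false); (inl g', false)] [:: (inl (g * g'), false)]
| FreeProduct_r (h h' : H) : free_product_rel
    [:: (inr h, false); (inr h', false)] [:: (inr (h * h'), false)].

Definition free_product : Type := presented free_product_rel.

HB.instance Definition _ := Group.on free_product.

Definition fpl (g : G) : free_product := generator free_product_rel (inl g).
Definition fpr (h : H) : free_product := generator free_product_rel (inr h).

Fact fplM : {morph fpl : g g' / g * g'}.
Proof.
move=> g g'; apply: etrans (esym (presented_mulE _ _ _)).
by apply/word_classP/Word_sym/Word_rel/FreeProduct_l.
Qed.
Fact fprM : {morph fpr : h h' / h * h'}.
Proof.
move=> h h'; apply: etrans (esym (presented_mulE _ _ _)).
by apply/word_classP/Word_sym/Word_rel/FreeProduct_r.
Qed.

HB.instance Definition _ := isMultiplicative.Build G free_product fpl fplM.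
HB.instance Definition _ := isMultiplicative.Build H free_product fpr fprM.

Fact fpl1 : fpl 1 = 1.
Proof. by apply: (@mulgI _ (fpl 1)); rewrite -fplM !mulg1. Qed.
Fact fpr1 : fpr 1 = 1.
Proof. by apply: (@mulgI _ (fpr 1)); rewrite -fprM !mulg1. Qed.
Fact fplV g : fpl g^-1 = (fpl g)^-1.
Proof. by apply: (@mulgI _ (fpl g)); rewrite -fplM !mulgV fpl1. Qed.
Fact fprV h : fpr h^-1 = (fpr h)^-1.
Proof. by apply: (@mulgI _ (fpr h)); rewrite -fprM !mulgV fpr1. Qed.

Fact free_product_ind (P : free_product -> Prop) :
    P 1 -> (forall g z, P z -> P (fpl g * z)) ->
    (forall h z, P z -> P (fpr h * z)) ->
  forall z, P z.
Proof.
move=> P1 Pl Pr; elim/presented_ind; elim=> [|[a b] w IHw]; first exact: P1.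
rewrite -cat1s -presented_mulE.
have genV c : word_class free_product_rel [:: (c, true)] =
              (generator free_product_rel c)^-1.
  apply: (@mulgI _ (generator free_product_rel c)); rewrite mulgV.
  apply: etrans (presented_mulE _ _ _) _.
  exact/word_classP/(Word_cancel _ c false).
by case: a b => [g|h] []; rewrite ?genV -?[generator _ (inl _)]/(fpl _)
  -?[generator _ (inr _)]/(fpr _) -?fplV -?fprV; [exact: Pl|exact: Pl|exact: Pr|exact: Pr].
Qed.

End FreeProduct.

Arguments fpl {G H} g.
Arguments fpr {G H} h.

Definition semidirect (A B : groupType) (to : gaction B A) : Type :=
  (A * B)%type.

Section Semidirect.
Variables (A B : groupType) (to : gaction B A).

Local Notation semidirect := (semidirect to).

HB.instance Definition _ := Choice.on semidirect.

Definition semidirect_one : semidirect := (1, 1).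
Definition semidirect_mul (x y : semidirect) : semidirect :=
  (x.1 * to x.2 y.1, x.2 * y.2).
Definition semidirect_inv (x : semidirect) : semidirect :=
  (to x.2^-1 x.1^-1, x.2^-1).

Fact gaction_1 b : to b 1 = 1.
Proof.
by apply: (@mulgI _ (to b 1)); rewrite -act_morph !mulg1.
Qed.

Fact semidirect_mulA : associative semidirect_mul.
Proof.
by move=> [a b] [a' b'] [a'' b'']; rewrite /semidirect_mul /= act_morph actM !mulgA.
Qed.
Fact semidirect_mul1 : left_id semidirect_one semidirect_mul.
Proof. by move=> [a b]; rewrite /semidirect_mul /= act1 !mul1g. Qed.
Fact semidirect_mulr1 : right_id semidirect_one semidirect_mul.
Proof. by move=> [a b]; rewrite /semidirect_mul /= gaction_1 !mulg1. Qed.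
Fact semidirect_mulV :
  left_inverse semidirect_one semidirect_inv semidirect_mul.
Proof.
by move=> [a b]; rewrite /semidirect_mul /= -act_morph !mulVg gaction_1.
Qed.
Fact semidirect_mulrV :
  right_inverse semidirect_one semidirect_inv semidirect_mul.
Proof.
by move=> [a b]; rewrite /semidirect_mul /= -actM !mulgV act1 mulgV.
Qed.

HB.instance Definition _ := isGroup.Build semidirect
  semidirect_mulA semidirect_mul1 semidirect_mulr1
  semidirect_mulV semidirect_mulrV.

End Semidirect.

(* rhoG and rhoH need not be the actions by conjugation. *)
Record mutual_actions (G H : groupType) := MutualActions {
  rhoG : gaction G G;
  rhoH : gaction H H;
  sigmaG : gaction G H;
  sigmaH : gaction H G
}.

Section Mutual.
Variables (G H : groupType) (M : mutual_actions G H).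

(* The action of the disjoint union of G and H on itself. *)
Definition uact (a b : G + H) : G + H :=
  match a, b with
  | inl g, inl g' => inl (rhoG M g g')
  | inl g, inr h => inr (sigmaG M g h)
  | inr h, inl g => inl (sigmaH M h g)
  | inr h, inr h' => inr (rhoH M h h')
  end.

Definition uinv (a : G + H) : G + H :=
  match a with inl g => inl g^-1 | inr h => inr h^-1 end.

Definition fully_compatible : Prop :=
  forall a b c : G + H,
    uact (uact a b) c = uact a (uact b (uact (uinv a) c)).

Definition box_symbol (g : G) (h : H) : G * H * bool := ((g, h), false).

Inductive box_rel : word (G * H)%type -> word (G * H)%type -> Prop :=
| Box_l (g g' : G) (h : H) : box_rel
    [:: box_symbol (g * g') h]
    [:: box_symbol (rhoG M g g') (sigmaG M g h); box_symbol g h]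
| Box_r (g : G) (h h' : H) : box_rel
    [:: box_symbol g (h * h')]
    [:: box_symbol g h; box_symbol (sigmaH M h g) (rhoH M h h')].

Definition box_tensor : Type := presented box_rel.

HB.instance Definition _ := Group.on box_tensor.

Definition fcomm (g : G) (h : H) : free_product G H := comm (fpl g) (fpr h).

Inductive fcomm_image : free_product G H -> Prop :=
| Fcomm_image g h : fcomm_image (fcomm g h).

(* The subgroup [G, H] of G * H: its normality is commutator_subgroup_conj. *)
Definition commutator_subgroup : groupClosed (free_product G H) :=
  gen fcomm_image.

Fact fcomm_in g h : fcomm g h \in commutator_subgroup.
Proof. by apply/asboolP/Gen_sub/Fcomm_image. Qed.

Fact commutator_subgroup_conj x y :
  x \in commutator_subgroup -> y * x * y^-1 \in commutator_subgroup.
Proof.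
have conjM (u v w : free_product G H) :
  w * (u * v) * w^-1 = w * u * w^-1 * (w * v * w^-1).
  by rewrite -!mulgA mulKg.
have conjG (w : free_product G H) :
    (forall g h, w * fcomm g h * w^-1 \in commutator_subgroup) ->
    forall z, z \in commutator_subgroup -> w * z * w^-1 \in commutator_subgroup.
  move=> Pw z /asboolP; elim=> {z} [_ [g h] // | | u v _ IHu _ IHv | u _ IHu].
  - by rewrite mulg1 mulgV gpred1.
  - by rewrite conjM gpredM.
  - by rewrite -gpredV !invgM !invgK mulgA.
move=> xK; elim/free_product_ind: y => [|a y IHy|a y IHy].
- by rewrite invg1 mul1g mulg1.
- rewrite invgM -!mulgA (mulgA x) (mulgA y) (mulgA (fpl a)).
  apply: conjG; last by rewrite mulgA.
  move=> g h; have -> : fpl a * fcomm g h * (fpl a)^-1 =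
                        fcomm (a * g) h * (fcomm a h)^-1.
    by rewrite /fcomm /comm fplM !invgM !invgK -!mulgA mulKg mulKg.
  by rewrite gpredM ?gpredV ?fcomm_in.
- rewrite invgM -!mulgA (mulgA x) (mulgA y) (mulgA (fpr a)).
  apply: conjG; last by rewrite mulgA.
  move=> g h; have -> : fpr a * fcomm g h * (fpr a)^-1 =
                        (fcomm g a)^-1 * fcomm g (a * h).
    by rewrite /fcomm /comm fprM !invgM !invgK -!mulgA !mulKg.
  by rewrite gpredM ?gpredV ?fcomm_in.
Qed.

Inductive R_set : free_product G H -> Prop :=
| Rel_l (x g : G) (h : H) of x != 1 & g != 1 & h != 1 :
    R_set (fpl x * (fcomm g h)^-1 * (fpl x)^-1
                  * fcomm (rhoG M x g) (sigmaG M x h))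
| Rel_r (y : H) (g : G) (h : H) of y != 1 & g != 1 & h != 1 :
    R_set (fpr y * (fcomm g h)^-1 * (fpr y)^-1
                  * fcomm (sigmaH M y g) (rhoH M y h)).

Definition R_closure : normal_subgroup (free_product G H) :=
  normal_closure R_set.

Fact R_closure_sub : {subset R_closure <= commutator_subgroup}.
Proof.
move=> z /asboolP; elim=> {z} [_ [y z Rz] | | u v _ IHu _ IHv | u _ IHu].
- apply: commutator_subgroup_conj.
  by case: Rz => *; rewrite gpredM ?commutator_subgroup_conj ?gpredV ?fcomm_in.
- exact: gpred1.
- exact: gpredM.
- by rewrite gpredV.
Qed.

Definition eta_group : Type := quotient R_closure.

HB.instance Definition _ := Group.on eta_group.

(* Here R_closure is contained in [G, H], by R_closure_sub. *)
Definition tau_group : Type := subquotient commutator_subgroup R_closure.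

HB.instance Definition _ := Group.on tau_group.

Definition tau_comm (g : G) (h : H) : tau_group :=
  quotient_pi (trace_normal commutator_subgroup R_closure)
    (Subgroup (fcomm_in g h)).

End Mutual.

(* Main.v *)
Require Import Defs.
From HB Require Import structures.
From mathcomp Require Import all_boot.
From mathcomp Require Import boolp.

(* The subgroup tau(G, H) is normal in eta(G, H), and conjugation there induces
   the actions of G and H on it, by the very relations R. Every element of
   eta(G, H) is a product b h g with b in tau(G, H), uniquely so because
   eta(G, H) retracts onto G and onto H, each retraction killing tau(G, H) and
   the other factor; this is the iterated semidirect product.
   The symbols of the box-tensor T map to the commutators, which gives a
   surjection T -> tau(G, H). For its injectivity, full compatibility lets G and
   H act on T and allows one to form (T x| H) x| G, which receives a map from
   eta(G, H) sending [g, h] to the symbol of (g, h). *)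

Set Implicit Arguments.
Unset Strict Implicit.
Unset Printing Implicit Defensive.

Local Open Scope group_scope.

(** * Homomorphisms and isomorphisms *)

Lemma multiplicative_of (A B : groupType) (f : A -> B) :
  {morph f : x y / x * y} -> exists f' : {multiplicative A -> B}, f' =1 f.
Proof.
move=> fM; pose m := isMultiplicative.Build _ _ f fM.
pose f' : {multiplicative A -> B} := HB.pack f m.
by exists f'.
Qed.

Lemma mult1 (A B : groupType) (f : {multiplicative A -> B}) : f 1 = 1.
Proof. by apply: (@mulgI _ (f 1)); rewrite -gmulfM !mulg1. Qed.

Lemma multV (A B : groupType) (f : {multiplicative A -> B}) :
  {morph f : x / x^-1}.
Proof. by move=> x; apply: (@mulgI _ (f x)); rewrite -gmulfM !mulgV mult1. Qed.

(** The direction is reversed on purpose: the maps built below start from the semidirect product and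
    from the box-tensor product, and end in eta and tau. *)
Lemma isomorphic_of_bij (A B : groupType) (f : {multiplicative A -> B}) :
  injective f -> (forall y, exists x, f x = y) -> isomorphic B A.
Proof.
move=> fI /choice[g gK]; have fK : cancel f g by move=> x; apply: fI.
have [g' g'E] := multiplicative_of (can2_gmulfM fK gK).
by exists g', f => x; rewrite g'E.
Qed.

(** * Universal properties of presentations and free products *)

Section PresentedUniversal.
Variables (X : choiceType) (E : word X -> word X -> Prop) (K : groupType).

Definition word_eval (F : X -> K) (w : word X) : K :=
  \prod_(a <- w) (if a.2 then (F a.1)^-1 else F a.1).

Lemma presented_lift (F : X -> K) :
    (forall u v, E u v -> word_eval F u = word_eval F v) ->
  exists f : {multiplicative presented E -> K},
    forall x, f (generator E x) = F x.
Proof.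
move=> FE.
have Feq u v : word_eq E u v -> word_eval F u = word_eval F v.
  elim=> {u v} [u v /FE // | x b | // | // | u v w _ -> _ -> // |].
    rewrite /word_eval big_cons big_seq1 big_nil /=.
    by case: b; rewrite /= ?mulgV ?mulVg.
  by move=> u u' v v' _ IHu _ IHv; rewrite /word_eval !big_cat /=; congr (_ * _).
have Fclass w : word_eval F (repr (word_class E w)) = word_eval F w.
  exact/Feq/word_class_repr.
have [|f fE] := @multiplicative_of (presented E) K (fun u => word_eval F (repr u)).
  elim/presented_ind=> u; elim/presented_ind=> v.
  by rewrite [_ * _]presented_mulE !Fclass /word_eval big_cat.
by exists f => x; rewrite fE Fclass /word_eval big_seq1.
Qed.

(** The maps are bare functions, so that the lemma applies directly to composites and to conjugates
    of homomorphisms. *)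
Lemma presented_ext (f f' : presented E -> K) :
    {morph f : u v / u * v} -> {morph f' : u v / u * v} ->
    (forall x, f (generator E x) = f' (generator E x)) ->
  f =1 f'.
Proof.
move=> /multiplicative_of[F FE] /multiplicative_of[F' F'E] ff' u.
rewrite -FE -F'E; move: u.
have {ff'}FF' x : F (generator E x) = F' (generator E x) by rewrite FE F'E.
elim/presented_ind; elim=> [|[x b] w IHw].
  by rewrite -[word_class E [::]]/(1 : presented E) !mult1.
have -> : word_class E ((x, b) :: w) =
    (if b then (generator E x)^-1 else generator E x) * word_class E w.
  rewrite -cat1s -presented_mulE; congr (_ * _).
  case: b => //; apply: (@mulgI _ (generator E x)); rewrite mulgV.
  by apply: etrans (presented_mulE _ _ _) _; apply/word_classP/(Word_cancel E x false).
by rewrite !gmulfM IHw; case: b; rewrite ?multV FF'.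
Qed.

End PresentedUniversal.

Lemma free_product_lift (G H K : groupType) (f : {multiplicative G -> K})
    (f' : {multiplicative H -> K}) :
  exists F : {multiplicative free_product G H -> K},
    (forall g, F (fpl g) = f g) /\ (forall h, F (fpr h) = f' h).
Proof.
pose F0 (a : G + H) := match a with inl g => f g | inr h => f' h end.
have [|F FE] := @presented_lift _ (@free_product_rel G H) K F0.
  by move=> u v [] x y; rewrite /word_eval big_cons !big_seq1 /= gmulfM.
by exists F; split=> x; rewrite FE.
Qed.

(** * Quotients, subquotients and conjugation *)

Lemma quotient_lift (G K : groupType) (N : normal_subgroup G)
    (f : {multiplicative G -> K}) :
    (forall x, x \in N -> f x = 1) ->
  exists f' : {multiplicative quotient N -> K},
    forall x, f' (quotient_pi N x) = f x.
Proof.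
move=> fN.
have fE x : f (repr (quotient_pi N x)) = f x.
  by have [n nN ->] := quotient_reprE N x; rewrite gmulfM (fN n) ?mulg1.
have [|f' f'E] := @multiplicative_of (quotient N) K (fun u => f (repr u)).
  elim/quotient_ind=> x; elim/quotient_ind=> y.
  by rewrite [_ * _]quotient_piM !fE gmulfM.
by exists f' => x; rewrite f'E fE.
Qed.

Lemma gen_trivial (G K : groupType) (S : G -> Prop)
    (f : {multiplicative G -> K}) :
  (forall x, S x -> f x = 1) -> forall x, x \in gen S -> f x = 1.
Proof.
move=> fS x /asboolP; elim=> {x} [x /fS // | | x y _ fx _ fy | x _ fx].
- exact: mult1.
- by rewrite gmulfM fx fy mulg1.
- by rewrite multV fx invg1.
Qed.

Lemma normal_closure_trivial (G K : groupType) (S : G -> Prop)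
    (f : {multiplicative G -> K}) :
  (forall x, S x -> f x = 1) -> forall x, x \in normal_closure S -> f x = 1.
Proof.
move=> fS; apply: gen_trivial => _ [x y Sx].
by rewrite !gmulfM multV (fS x)// mulg1 mulgV.
Qed.

(** Cosets of the trace of [N] on [K] are equal exactly when they lie in the same coset of [N]. This
    turns identities in tau into identities in eta. *)
Lemma subquotient_inj (G : groupType) (K : groupClosed G)
    (N : normal_subgroup G) :
  exists j : {multiplicative subquotient K N -> quotient N}, injective j /\
    forall k, j (quotient_pi (trace_normal K N) k) =
              quotient_pi N (subgroup_val k).
Proof.
have [|p pE] := @multiplicative_of (subgroup K) (quotient N)
  (fun k => quotient_pi N (subgroup_val k)).
  by move=> x y; rewrite subgroup_valM -quotient_piM.
have [|j jE] := @quotient_lift _ _ (trace_normal K N) p.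
  by move=> x xN; rewrite pE; apply/esym/quotient_piP; rewrite invg1 mul1g.
exists j; split=> [|k]; last by rewrite jE pE.
elim/quotient_ind=> x; elim/quotient_ind=> y.
rewrite !jE !pE => /quotient_piP xy; apply/quotient_piP.
by rewrite [_ \in _]/(subgroup_val (x^-1 * y) \in N).
Qed.

(** The laws of an action hold for conjugation in [Y] and are pulled back along the injective [j].
    All three actions of the theorem arise in this way. *)
Lemma conjugation_action (A X Y : groupType) (i : {multiplicative A -> Y})
    (j : {multiplicative X -> Y}) :
    injective j -> (forall a x, exists x', j x' = i a * j x * (i a)^-1) ->
  exists to : gaction A X, forall a x, j (to a x) = i a * j x * (i a)^-1.
Proof.
move=> jI ij.
have /choice[t tE] (ax : A * X) : exists x', j x' = i ax.1 * j ax.2 * (i ax.1)^-1.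
  exact: ij.
have t1 x : t (1, x) = x by apply: jI; rewrite tE /= mult1 invg1 mul1g mulg1.
have tM a b x : t (a * b, x) = t (a, t (b, x)).
  by apply: jI; rewrite !tE /= gmulfM invgM !mulgA.
have t_morph a : {morph (fun x => t (a, x)) : x y / x * y}.
  by move=> x y; apply: jI; rewrite gmulfM !tE /= gmulfM -!mulgA mulKg.
by exists (GAction t1 tM t_morph) => a x; rewrite /= tE.
Qed.

(** * Homomorphisms out of a semidirect product *)

Lemma semidirectM (A B : groupType) (to : gaction B A) (a a' : A) (b b' : B) :
  ((a, b) : semidirect to) * (a', b') = (a * to b a', b * b').
Proof. by []. Qed.

Lemma semidirect_lift (A B Y : groupType) (to : gaction B A)
    (j : {multiplicative A -> Y}) (i : {multiplicative B -> Y}) :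
    (forall b a, j (to b a) = i b * j a * (i b)^-1) ->
  exists f : {multiplicative semidirect to -> Y},
    forall a b, f (a, b) = j a * i b.
Proof.
move=> toE.
have [|f fE] := @multiplicative_of (semidirect to) Y (fun x => j x.1 * i x.2).
  by move=> [a b] [a' b']; rewrite semidirectM /= !gmulfM toE !mulgA mulgVK.
by exists f => a b; rewrite fE.
Qed.

(** The retraction [r] reads [b] off the product [j a * i b]; cancelling [i b] then leaves [j a]. *)
Lemma semidirect_lift_inj (A B Y : groupType) (to : gaction B A)
    (j : {multiplicative A -> Y}) (i : {multiplicative B -> Y})
    (r : {multiplicative Y -> B}) (f : {multiplicative semidirect to -> Y}) :
    injective j -> (forall a, r (j a) = 1) -> (forall b, r (i b) = b) ->
    (forall a b, f (a, b) = j a * i b) ->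
  injective f.
Proof.
move=> jI rj ri fE [a b] [a' b']; rewrite !fE => e.
have eb : b = b' by have := congr1 r e; rewrite !gmulfM !rj !ri !mul1g.
by move: e; rewrite eb => /mulIg/jI->.
Qed.

(** The argument of [f] on the left has the shape of the elements of [R_set]: killing a relator
    means that conjugation by [x] realizes the action. *)
Lemma mult_conj (A B : groupType) (f : {multiplicative A -> B}) (x y z : A) :
  f (x * y^-1 * x^-1 * z) = 1 <-> f z = f x * f y * (f x)^-1.
Proof.
rewrite !gmulfM !multV; split=> [e | ->]; last by rewrite !mulgA !mulgVK mulgV.
apply: (@mulgI _ (f x * (f y)^-1 * (f x)^-1)).
by rewrite e !mulgA !mulgVK mulgV.
Qed.

(** * The decomposition of eta *)

Section EtaTau.
Variables (G H : groupType) (M : mutual_actions G H).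

Local Notation eta := (eta_group M).
Local Notation tau := (tau_group M).

Lemma eta_lift (K : groupType) (f : {multiplicative free_product G H -> K}) :
    (forall z, R_set M z -> f z = 1) ->
  exists f' : {multiplicative eta -> K},
    forall z, f' (quotient_pi (R_closure M) z) = f z.
Proof. by move=> fR; apply/quotient_lift/normal_closure_trivial. Qed.

Lemma eta_proj : exists p : {multiplicative free_product G H -> eta},
  p =1 quotient_pi (R_closure M).
Proof. by apply: multiplicative_of => x y; rewrite -quotient_piM. Qed.

(** [R_set] only covers nontrivial elements. The remaining cases hold since 1 acts trivially,
    actions fix 1, and a commutator with 1 is trivial. *)
Lemma eta_relation (p : {multiplicative free_product G H -> eta}) :
    p =1 quotient_pi (R_closure M) ->
  (forall x g h, p (fcomm (rhoG M x g) (sigmaG M x h)) =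
                 p (fpl x) * p (fcomm g h) * (p (fpl x))^-1) /\
  (forall y g h, p (fcomm (sigmaH M y g) (rhoH M y h)) =
                 p (fpr y) * p (fcomm g h) * (p (fpr y))^-1).
Proof.
move=> pE.
have f1l (h : H) : fcomm (1 : G) h = 1.
  by rewrite /fcomm /comm fpl1 invg1 mul1g mulg1 mulgV.
have f1r (g : G) : fcomm g (1 : H) = 1.
  by rewrite /fcomm /comm fpr1 invg1 !mulg1 mulgV.
have pR z : R_set M z -> p z = 1.
  move=> Rz; rewrite pE; apply/esym/quotient_piP; rewrite invg1 mul1g.
  apply/asboolP/Gen_sub.
  have -> : z = 1 * z * 1^-1 by rewrite invg1 mul1g mulg1.
  exact: Conjugate_of.
split=> x g h.
- have [->|x1] := eqVneq x 1.
    by rewrite !act1 fpl1 mult1 invg1 mul1g mulg1.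
  have [->|g1] := eqVneq g 1.
    by rewrite gaction_1 !f1l mult1 mulg1 mulgV.
  have [->|h1] := eqVneq h 1.
    by rewrite gaction_1 !f1r mult1 mulg1 mulgV.
  exact/mult_conj/pR/Rel_l.
- have [->|x1] := eqVneq x 1.
    by rewrite !act1 fpr1 mult1 invg1 mul1g mulg1.
  have [->|g1] := eqVneq g 1.
    by rewrite gaction_1 !f1l mult1 mulg1 mulgV.
  have [->|h1] := eqVneq h 1.
    by rewrite gaction_1 !f1r mult1 mulg1 mulgV.
  exact/mult_conj/pR/Rel_r.
Qed.

(** Identifies tau with the image of [G, H] in eta. *)
Lemma tau_inj (p : {multiplicative free_product G H -> eta}) :
    p =1 quotient_pi (R_closure M) ->
  exists j : {multiplicative tau -> eta}, [/\ injective j,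
    forall g h, j (tau_comm M g h) = p (fcomm g h),
    forall z, z \in commutator_subgroup G H -> exists b, j b = p z &
    forall b, exists2 z, z \in commutator_subgroup G H & j b = p z].
Proof.
move=> pE; have [j [jI jE]] := subquotient_inj (commutator_subgroup G H) (R_closure M).
exists j; split=> // [g h | z zK |].
- by rewrite jE pE.
- by exists (quotient_pi _ (Subgroup zK)); rewrite jE pE.
- by elim/quotient_ind=> -[z zK]; exists z; rewrite // jE pE.
Qed.

Lemma eta_semidirect :
  exists (actG : gaction G tau) (actH : gaction H tau),
     [/\ forall (x : G) (g : G) (h : H),
           actG x (tau_comm M g h) = tau_comm M (rhoG M x g) (sigmaG M x h),
         forall (y : H) (g : G) (h : H),
           actH y (tau_comm M g h) = tau_comm M (sigmaH M y g) (rhoH M y h) &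
         exists actG' : gaction G (semidirect actH),
           (forall (g : G) (b : tau) (h : H),
              actG' g (b, h) = (actG g b * tau_comm M g h, h)) /\
           isomorphic eta (semidirect actG')].
Proof.
have [p pE] := eta_proj; have [relG relH] := eta_relation pE.
have [j [jI jC Kj jK]] := tau_inj pE.
have [iG iGE] := @multiplicative_of G eta (fun g => p (fpl g))
  (fun x y => etrans (congr1 p (fplM H x y)) (gmulfM _ _)).
have [iH iHE] := @multiplicative_of H eta (fun h => p (fpr h))
  (fun x y => etrans (congr1 p (fprM G x y)) (gmulfM _ _)).
have normG g b : exists b', j b' = iG g * j b * (iG g)^-1.
  have [z zK ->] := jK b; rewrite iGE -multV -!gmulfM.
  by apply: Kj; apply: commutator_subgroup_conj.
have normH h b : exists b', j b' = iH h * j b * (iH h)^-1.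
  have [z zK ->] := jK b; rewrite iHE -multV -!gmulfM.
  by apply: Kj; apply: commutator_subgroup_conj.
have [aG aGE] := conjugation_action jI normG.
have [aH aHE] := conjugation_action jI normH.
exists aG, aH; split=> [x g h | y g h |].
- by apply: jI; rewrite aGE !jC relG iGE.
- by apply: jI; rewrite aHE !jC relH iHE.
have [unitGH unitGHE] := @multiplicative_of G H (fun=> 1) (fun _ _ => esym (mulg1 1)).
have [unitHG unitHGE] := @multiplicative_of H G (fun=> 1) (fun _ _ => esym (mulg1 1)).
(* If the images of [uG] and [uH] commute, the induced map on the free product kills [G, H], hence
   also the relators. Pairing an identity with a trivial map gives the retractions onto [G] and
   [H]. *)
have retraction (K : groupType) (uG : {multiplicative G -> K}) (uH : {multiplicative H -> K}) :
    (forall g h, comm (uG g) (uH h) = 1) ->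
  exists r : {multiplicative eta -> K}, [/\ forall g, r (iG g) = uG g,
    forall h, r (iH h) = uH h & forall b, r (j b) = 1].
  move=> uGH; have [F [Fl Fr]] := free_product_lift uG uH.
  have FK z : z \in commutator_subgroup G H -> F z = 1.
    apply: gen_trivial => _ [g h].
    by rewrite /fcomm /comm !gmulfM !multV Fl Fr; apply: uGH.
  have [|r rE] := @quotient_lift _ _ (R_closure M) F.
    by move=> z /R_closure_sub/FK.
  exists r; split=> [g | h | b]; first by rewrite iGE pE rE.
    by rewrite iHE pE rE.
  by have [z zK ->] := jK b; rewrite pE rE FK.
have [|rG [rGG rGH rGj]] := retraction G idfun unitHG.
  by move=> g h; rewrite /comm unitHGE invg1 !mulg1 mulgV.
have [|rH [rHG rHH rHj]] := retraction H unitGH idfun.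
  by move=> g h; rewrite /comm unitGHE invg1 mul1g mulg1 mulgV.
have [k kE] := semidirect_lift aHE.
have kI := semidirect_lift_inj jI rHj rHH kE.
(* This is where the twist by [g, h] comes from: conjugating [h] by [g] gives [g, h] h. *)
have iGk g b h : iG g * k (b, h) * (iG g)^-1 = k (aG g b * tau_comm M g h, h).
  rewrite !kE gmulfM aGE jC iGE iHE /fcomm /comm !gmulfM !multV.
  by rewrite !mulgA !mulgVK.
have [|aG' aG'E] := @conjugation_action G _ _ iG k kI.
  by move=> g [b h]; exists (aG g b * tau_comm M g h, h); rewrite iGk.
exists aG'; split=> [g b h|]; first by apply: kI; rewrite aG'E iGk.
have [f fE] := semidirect_lift aG'E.
apply: (@isomorphic_of_bij _ _ f) => [|].
  apply: (semidirect_lift_inj kI _ rGG fE) => -[b h].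
  by rewrite kE gmulfM rGj rGH unitHGE mulg1.
(* Surjectivity, one letter at a time: a letter [x] of [G] is moved past the component in tau and
   [H] by conjugation, a letter [y] of [H] past the component in tau only. *)
elim/quotient_ind=> z; rewrite -pE.
elim/free_product_ind: z => [|x z [[[b h] g] IH]|y z [[[b h] g] IH]].
- by exists 1; rewrite !mult1.
- exists (aG' x (b, h), x * g).
  by rewrite gmulfM -IH !fE aG'E gmulfM -iGE !mulgA mulgVK.
- exists ((aH y b, y * h), g).
  by rewrite gmulfM -IH !fE !kE aHE gmulfM -iHE !mulgA mulgVK.
Qed.

End EtaTau.

(** * The box-tensor product *)

Section Box.
Variables (G H : groupType) (M : mutual_actions G H).

Local Notation box_group := (box_tensor M).
Local Notation box g h := (generator (box_rel M) (g, h) : box_group).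

Lemma boxMl g g' h : box (g * g') h = box (rhoG M g g') (sigmaG M g h) * box g h.
Proof.
apply: etrans (esym (presented_mulE _ _ _)).
exact/word_classP/Word_rel/Box_l.
Qed.

Lemma boxMr g h h' : box g (h * h') = box g h * box (sigmaH M h g) (rhoH M h h').
Proof.
apply: etrans (esym (presented_mulE _ _ _)).
exact/word_classP/Word_rel/Box_r.
Qed.

Lemma box1l h : box 1 h = 1.
Proof.
by apply: (@mulIg _ (box 1 h)); have := boxMl 1 1 h; rewrite !act1 !mul1g => <-.
Qed.

Lemma box1r g : box g 1 = 1.
Proof.
by apply: (@mulgI _ (box g 1)); have := boxMr g 1 1; rewrite !act1 !mulg1 => <-.
Qed.

Lemma box_lift (K : groupType) (F : G -> H -> K) :
    (forall g g' h, F (g * g') h = F (rhoG M g g') (sigmaG M g h) * F g h) ->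
    (forall g h h', F g (h * h') = F g h * F (sigmaH M h g) (rhoH M h h')) ->
  exists f : {multiplicative box_group -> K}, forall g h, f (box g h) = F g h.
Proof.
move=> Fl Fr.
have [|f fE] := @presented_lift _ (box_rel M) K (fun gh => F gh.1 gh.2).
  by move=> u v [] >; rewrite /word_eval !big_cons !big_nil !mulg1 /= ?Fl ?Fr.
by exists f => g h; rewrite fE.
Qed.

Lemma box_ext (K : groupType) (f f' : box_group -> K) :
    {morph f : u v / u * v} -> {morph f' : u v / u * v} ->
  (forall g h, f (box g h) = f' (box g h)) -> f =1 f'.
Proof. by move=> fM f'M ff'; apply: presented_ext => // -[]. Qed.

(** The four equivariance hypotheses make the diagonal action on pairs send defining relations to
    defining relations; the laws of an action are then checked on symbols. *)
Lemma box_action (A : groupType) (aG : gaction A G) (aH : gaction A H) :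
    (forall x g g', aG x (rhoG M g g') = rhoG M (aG x g) (aG x g')) ->
    (forall x g h, aH x (sigmaG M g h) = sigmaG M (aG x g) (aH x h)) ->
    (forall x g h, aG x (sigmaH M h g) = sigmaH M (aH x h) (aG x g)) ->
    (forall x h h', aH x (rhoH M h h') = rhoH M (aH x h) (aH x h')) ->
  exists to : gaction A box_group,
    forall x g h, to x (box g h) = box (aG x g) (aH x h).
Proof.
move=> GG GH HG HH.
have /choice[f fE] x : exists f : {multiplicative box_group -> box_group},
    forall g h, f (box g h) = box (aG x g) (aH x h).
  apply: (@box_lift _ (fun g h => box (aG x g) (aH x h))) => [g g' h | g h h'].
    by rewrite act_morph boxMl GG GH.
  by rewrite act_morph boxMr HG HH.
have f1 t : f 1 t = t.
  move: t; apply: (@box_ext _ (f 1) id) => [||g h] //; first exact: gmulfM.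
  by rewrite fE !act1.
have fM x y t : f (x * y) t = f x (f y t).
  move: t; apply: box_ext => [||g h]; first exact: gmulfM.
    by move=> u v; rewrite !gmulfM.
  by rewrite !fE !actM.
by exists (GAction f1 fM (fun x => @gmulfM _ _ (f x))).
Qed.

(** * Consequences of full compatibility *)

Hypothesis compat : fully_compatible M.

(** Full compatibility applied to [uact M a c] in place of [c], where the inverse of [a] cancels
    [a]. *)
Lemma uact_equivariant a b c :
  uact M a (uact M b c) = uact M (uact M a b) (uact M a c).
Proof.
rewrite compat; congr (uact M a (uact M b _)).
by case: a c => a [] c /=; rewrite -actM mulVg act1.
Qed.

Lemma box_actionG : exists to : gaction G box_group,
  forall x g h, to x (box g h) = box (rhoG M x g) (sigmaG M x h).
Proof.
apply: box_action => x u v.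
- by have [] := uact_equivariant (inl x) (inl u) (inl v).
- by have [] := uact_equivariant (inl x) (inl u) (inr v).
- by have [] := uact_equivariant (inl x) (inr v) (inl u).
- by have [] := uact_equivariant (inl x) (inr u) (inr v).
Qed.

Lemma box_actionH : exists to : gaction H box_group,
  forall y g h, to y (box g h) = box (sigmaH M y g) (rhoH M y h).
Proof.
apply: box_action => y u v.
- by have [] := uact_equivariant (inr y) (inl u) (inl v).
- by have [] := uact_equivariant (inr y) (inl u) (inr v).
- by have [] := uact_equivariant (inr y) (inr v) (inl u).
- by have [] := uact_equivariant (inr y) (inr u) (inr v).
Qed.

Section Actions.
Variables (aG : gaction G box_group) (aH : gaction H box_group).
Hypothesis aGE : forall x g h, aG x (box g h) = box (rhoG M x g) (sigmaG M x h).
Hypothesis aHE : forall y g h, aH y (box g h) = box (sigmaH M y g) (rhoH M y h).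

(* Conjugation by the symbol of (g, h) is the action of g h g^-1 h^-1: compare
   the two ways of expanding the symbol of (g g', h h'). *)
Lemma box_swap g h t : aG g (aH h t) * box g h = box g h * aH h (aG g t).
Proof.
(* In this form both sides are multiplicative in [t], so that it suffices to compare them on
   symbols. *)
suff e : aG g (aH h t) = box g h * aH h (aG g t) * (box g h)^-1.
  by rewrite e mulgVK.
move: t; apply: (@box_ext _ (fun t => aG g (aH h t))
  (fun t => box g h * aH h (aG g t) * (box g h)^-1)) => [u v|u v|g' h'].
- by rewrite !act_morph.
- by rewrite !act_morph -!mulgA mulKg.
have e1 : sigmaH M (sigmaG M g h) (rhoG M g g') = rhoG M g (sigmaH M h g').
  by have [] := uact_equivariant (inl g) (inr h) (inl g').
have e2 : rhoH M (sigmaG M g h) (sigmaG M g h') = sigmaG M g (rhoH M h h').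
  by have [] := uact_equivariant (inl g) (inr h) (inr h').
have e3 : rhoG M (sigmaH M h g) (sigmaH M h g') = sigmaH M h (rhoG M g g').
  by have [] := uact_equivariant (inr h) (inl g) (inl g').
have e4 : sigmaG M (sigmaH M h g) (rhoH M h h') = rhoH M h (sigmaG M g h').
  by have [] := uact_equivariant (inr h) (inl g) (inr h').
apply: (@mulIg _ (box g h)); rewrite mulgVK !(aGE, aHE).
have := boxMr (g * g') h h'; rewrite (boxMl g g' (h * h')) (boxMl g g' h).
rewrite (act_morph (sigmaG M) g) (act_morph (sigmaH M) h) !boxMr boxMl.
rewrite e1 e2 e3 e4.
(* Both expansions begin with [box (rhoG M g g') (sigmaG M g h)] and end with
   [box (sigmaH M h g) (rhoH M h h')]; these are cancelled. *)
by rewrite -!mulgA => /mulgI; rewrite !mulgA => /mulIg.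
Qed.

(** The left relation of the box-tensor product gives the composition law. Multiplicativity is the
    right relation together with [box_swap], which carries [box g h] past the second factor. *)
Lemma box_semidirect_action : exists aG' : gaction G (semidirect aH),
  forall g t h, aG' g (t, h) = (aG g t * box g h, h).
Proof.
pose a g (z : semidirect aH) : semidirect aH := (aG g z.1 * box g z.2, z.2).
have a1 z : a 1 z = z by case: z => t h; rewrite /a act1 box1l mulg1.
have aM g g' z : a (g * g') z = a g (a g' z).
  by case: z => t h; rewrite /a /= actM boxMl act_morph aGE mulgA.
have a_morph g : {morph a g : z z' / z * z'}.
  move=> [t h] [t' h']; rewrite semidirectM /a /= semidirectM.
  rewrite !act_morph boxMr aHE !mulgA.
  by rewrite -(mulgA (aG g t)) box_swap !mulgA.
by exists (GAction a1 aM a_morph).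
Qed.

End Actions.

Lemma eta_to_box_semidirect : exists (aH : gaction H box_group)
    (aG' : gaction G (semidirect aH))
    (f : {multiplicative eta_group M -> semidirect aG'}),
  forall g h, f (quotient_pi (R_closure M) (fcomm g h)) = ((box g h, 1), 1).
Proof.
have [aG aGE] := box_actionG; have [aH aHE] := box_actionH.
have [aG' aG'E] := box_semidirect_action aGE aHE.
pose W : groupType := semidirect aG'.
have [|iG iGE] := @multiplicative_of G W (fun g => ((1, 1), g)).
  by move=> x y; rewrite semidirectM gaction_1 mulg1.
have [|iH iHE] := @multiplicative_of H W (fun h => ((1, h), 1)).
  by move=> x y; rewrite semidirectM act1 mulg1 semidirectM gaction_1 mulg1.
have [F [Fl Fr]] := free_product_lift iG iH.
have FC g h : F (fcomm g h) = ((box g h, 1), 1).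
  rewrite /fcomm /comm !gmulfM !multV Fl Fr iGE iHE.
  (* Inverses in [W] are avoided by checking g h = [g, h] h g instead. *)
  apply: (@mulIg _ (((1, h), 1) : W)); rewrite mulgVK.
  apply: (@mulIg _ (((1, 1), g) : W)); rewrite mulgVK.
  rewrite !semidirectM !act1 aG'E !semidirectM !act1 !gaction_1.
  by rewrite !mulg1 !mul1g.
have FR z : R_set M z -> F z = 1.
  case=> {z} x g h _ _ _; apply/mult_conj.
  - rewrite !FC Fl iGE.
    (* Acting by [x] on a pair with trivial second component adds the factor [box x 1], which is
       trivial. *)
    apply: (@mulIg _ (((1, 1), x) : W)); rewrite mulgVK !semidirectM !aG'E.
    by rewrite aGE !semidirectM !box1r !act1 !mulg1 !mul1g.
  - rewrite !FC Fr iHE.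
    apply: (@mulIg _ (((1, x), 1) : W)); rewrite mulgVK !semidirectM.
    by rewrite !act1 !semidirectM aHE act1 !mulg1 !mul1g.
have [f fE] := eta_lift FR.
by exists aH, aG', f => g h; rewrite fE FC.
Qed.

Lemma tau_box : isomorphic (tau_group M) box_group.
Proof.
have [p pE] := eta_proj M; have [relG relH] := eta_relation pE.
have [j [jI jC Kj jK]] := tau_inj pE.
(* The relations hold by the identities [g g', h] = (g [g', h] g^-1) [g, h] and [g, h h'] = [g, h]
   (h [g, h'] h^-1), conjugation in eta being the action. *)
have [g g' h|g h h'|phi phiE] := @box_lift _ (tau_comm M).
- apply: jI; rewrite gmulfM !jC relG -multV -!gmulfM; congr (p _).
  by rewrite /fcomm /comm fplM !invgM !mulgA !mulgVK.
- apply: jI; rewrite gmulfM !jC relH -multV -!gmulfM; congr (p _).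
  by rewrite /fcomm /comm fprM !invgM !mulgA !mulgVK.
apply: (@isomorphic_of_bij _ _ phi) => [t u|b].
  have [aH [aG' [f fE]]] := eta_to_box_semidirect.
  (* Thus [v] can be recovered from [phi v], which gives injectivity. *)
  have fK v : f (j (phi v)) = ((v, 1), 1).
    move: v; apply: box_ext => [u' v'|u' v'|g h]; first by rewrite !gmulfM.
      by rewrite semidirectM act1 mulg1 semidirectM act1 mulg1.
    by rewrite phiE jC pE fE.
  by move=> /(congr1 (f \o j)) /=; rewrite !fK => -[].
(* Surjectivity: the commutators generate [G, H] as a subgroup, and each is the image of a
   symbol. *)
have phiK z : z \in commutator_subgroup G H -> exists t, j (phi t) = p z.
  move=> /asboolP; elim=> {z} [_ [g h]||x y _ [t tE] _ [u uE]|x _ [t tE]].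
  - by exists (box g h); rewrite phiE jC.
  - by exists 1; rewrite !mult1.
  - by exists (t * u); rewrite !gmulfM tE uE.
  - by exists t^-1; rewrite !multV tE.
by have [z /phiK[t tE] bE] := jK b; exists t; apply: jI; rewrite tE bE.
Qed.

End Box.

Theorem theorem5p2 (G H : groupType) (M : mutual_actions G H)
    (compat : fully_compatible M) :
  (exists (actG : gaction G (tau_group M)) (actH : gaction H (tau_group M)),
     [/\ forall (x : G) (g : G) (h : H),
           actG x (tau_comm M g h) = tau_comm M (rhoG M x g) (sigmaG M x h),
         forall (y : H) (g : G) (h : H),
           actH y (tau_comm M g h) = tau_comm M (sigmaH M y g) (rhoH M y h) &
         exists actG' : gaction G (semidirect actH),
           (forall (g : G) (b : tau_group M) (h : H),
              actG' g (b, h) = (actG g b * tau_comm M g h, h)) /\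
           isomorphic (eta_group M) (semidirect actG')])
  /\ isomorphic (tau_group M) (box_tensor M).
Proof. by split; [exact: eta_semidirect | exact: tau_box]. Qed.
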